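(* For every fixed integer $R\ge 0$, $K^+(n,R)\in\Theta(2^n/n^R)$ as $n\to\infty$; that is, there are constants $c_R,C_R>0$ (depending only on $R$) and $n_0$ such that $c_R\,2^n/n^R\le K^+(n,R)\le C_R\,2^n/n^R$ for all integers $n\ge n_0$.
   Context: $Q_n=\{0,1\}^n$ is ordered by $x\preceq y$ iff $x_i\le y_i$ for all $i$, and $d(x,y)$ is the Hamming distance. The downward directed ball is $B_n^-(x,R)=\{y\in Q_n: y\preceq x,\ d(x,y)\le R\}$. A set $\mathcal{C}\subseteq Q_n$ downward $R$-covers $Q_n$ if $Q_n=\bigcup_{c\in\mathcal{C}}B_n^-(c,R)$. $K^+(n,R)$ denotes the minimum size of a set $\mathcal{C}\subseteq Q_n$ that downward $R$-covers $Q_n$ (in particular $K^+(n,R)=1$ for $R\ge n$). *)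

(* Defs.v *)
From mathcomp Require Import all_boot all_order all_algebra.
From mathcomp Require Import reals.

Set Implicit Arguments.
Unset Strict Implicit.
Unset Printing Implicit Defensive.

Definition cube (n : nat) : finType := {ffun 'I_n -> bool}.

(* The comparison of coordinates goes through the coercion of bool to nat. *)
Definition cube_le (n : nat) (x y : cube n) : bool := [forall i, x i <= y i].

Definition hamming (n : nat) (x y : cube n) : nat := #|[set i | x i != y i]|.

Definition down_ball (n : nat) (x : cube n) (R : nat) : {set cube n} :=
  [set y | cube_le y x && (hamming x y <= R)].

Definition down_covers (n R : nat) (C : {set cube n}) : bool :=
  \bigcup_(c in C) down_ball c R == [set: cube n].

Lemma down_ball_refl (n : nat) (x : cube n) (R : nat) : x \in down_ball x R.
Proof.
rewrite inE; apply/andP; split; first by apply/forallP.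
by rewrite /hamming (_ : [set _ | _] = set0) ?cards0 //;
  apply/setP => i; rewrite !inE eqxx.
Qed.

Lemma down_covers_setT (n R : nat) : down_covers R [set: cube n].
Proof.
apply/eqP/setP => x; rewrite [RHS]inE; apply/bigcupP.
by exists x; [rewrite inE | exact: down_ball_refl].
Qed.

(* [arg min] is meaningful because its starting point, the whole cube, is a
   covering by down_covers_setT. *)
Definition Kplus (n R : nat) : nat :=
  #|[arg min_(C < [set: cube n] | down_covers R C) #|C| ]|.

Lemma KplusP (n R : nat) :
  (exists2 C : {set cube n}, down_covers R C & #|C| = Kplus n R) /\
  (forall C : {set cube n}, down_covers R C -> Kplus n R <= #|C|).
Proof.
rewrite /Kplus; case: arg_minnP => [|C covC minC]; first exact: down_covers_setT.
by split=> //; exists C.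
Qed.

(* Main.v *)
Require Import Defs.
From mathcomp Require Import all_boot all_order all_algebra.
From mathcomp Require Import reals zify.
Import Order.TTheory GRing.Theory Num.Theory.
Local Open Scope ring_scope.

(** For the upper bound at radius 1, give coordinate [i] of a block of [m]
coordinates the weight [i] in Z/m. For each class [c], a word [u] is either
covered by a word of weight [c], namely by raising its coordinate
[c - weight u], or that coordinate is already raised. On a further block of [q]
coordinates the words of weight [c] are completed arbitrarily, the words of the
second kind by a covering of the [q]-cube. Averaging over [c] gives
[K(m+q,1) <= 2^(m+q) / m + 2^(m-1) K(q,1)], and with [m] about a quarter of the
length this yields [K(n,1) = O(2^n / n)]. Larger radii follow by splitting the
coordinates, [K(m+q,R+S) <= K(m,R) K(q,S)]. The lower bound is sphere
covering. *)

(** * Elementary facts on cubes, distances and coverings *)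

Lemma leq_exp2rW (m n e : nat) : (m <= n)%N -> (m ^ e <= n ^ e)%N.
Proof. by case: e => // e; rewrite leq_exp2r. Qed.

Lemma card_cube (n : nat) : #|cube n| = (2 ^ n)%N.
Proof. by rewrite card_ffun card_bool card_ord. Qed.

Lemma hammingE (n : nat) (x y : cube n) :
  hamming x y = (\sum_i (x i != y i))%N.
Proof.
rewrite /hamming -sum1dep_card big_mkcond; apply: eq_bigr => i _.
by case: (x i != y i).
Qed.

Lemma down_coversP (n R : nat) (C : {set cube n}) :
  reflect (forall x, exists2 c, c \in C & x \in down_ball c R)
          (down_covers R C).
Proof.
apply: (iffP eqP) => [covC x | covC].
  by apply/bigcupP; rewrite covC inE.
by apply/setP => x; rewrite [RHS]inE; apply/bigcupP.
Qed.

Lemma Kplus_le_card (n R : nat) (C : {set cube n}) :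
  down_covers R C -> (Kplus n R <= #|C|)%N.
Proof. exact: (KplusP n R).2. Qed.

Lemma Kplus_le_exp2 (n R : nat) : (Kplus n R <= 2 ^ n)%N.
Proof. by rewrite -card_cube -cardsT Kplus_le_card ?down_covers_setT. Qed.

(** * Products of coverings on two blocks of coordinates *)

Definition cube_join (m q : nat) (u : cube m) (v : cube q) : cube (m + q) :=
  [ffun i => match split i with inl j => u j | inr j => v j end].

Lemma cube_join_lshift (m q : nat) (u : cube m) (v : cube q) (j : 'I_m) :
  cube_join m q u v (lshift q j) = u j.
Proof. by rewrite ffunE (unsplitK (inl j)). Qed.

Lemma cube_join_rshift (m q : nat) (u : cube m) (v : cube q) (j : 'I_q) :
  cube_join m q u v (rshift m j) = v j.
Proof. by rewrite ffunE (unsplitK (inr j)). Qed.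

Lemma cube_joinP (m q : nat) (x : cube (m + q)) :
  exists u v, x = cube_join m q u v.
Proof.
exists [ffun j => x (lshift q j)], [ffun j => x (rshift m j)].
by apply/ffunP => i; rewrite ffunE; case: split_ordP => j ->; rewrite ffunE.
Qed.

Lemma down_ball_join (m q R S : nat) (u c : cube m) (v d : cube q) :
  u \in down_ball c R -> v \in down_ball d S ->
  cube_join m q u v \in down_ball (cube_join m q c d) (R + S).
Proof.
rewrite !inE => /andP[/forallP le_uc ucR] /andP[/forallP le_vd vdS].
apply/andP; split.
  by apply/forallP => i; rewrite !ffunE; case: (split i).
rewrite hammingE big_split_ord /=.
under eq_bigr do rewrite !cube_join_lshift.
under [X in (_ + X)%N]eq_bigr do rewrite !cube_join_rshift.
by rewrite -!hammingE leq_add.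
Qed.

Definition code_join (m q : nat) (A : {set cube m}) (B : {set cube q}) :=
  [set cube_join m q p.1 p.2 | p in setX A B].

Lemma mem_code_join (m q : nat) (A : {set cube m}) (B : {set cube q}) u v :
  u \in A -> v \in B -> cube_join m q u v \in code_join m q A B.
Proof.
by move=> uA vB; apply/imsetP; exists (u, v) => //; rewrite inE uA vB.
Qed.

Lemma card_code_join (m q : nat) (A : {set cube m}) (B : {set cube q}) :
  (#|code_join m q A B| <= #|A| * #|B|)%N.
Proof. by rewrite -cardsX leq_imset_card. Qed.

Lemma Kplus_join (m q R S : nat) :
  (Kplus (m + q) (R + S) <= Kplus m R * Kplus q S)%N.
Proof.
have [[C /down_coversP covC <-] _] := KplusP m R.
have [[D /down_coversP covD <-] _] := KplusP q S.
apply: leq_trans (card_code_join m q C D); apply: Kplus_le_card.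
apply/down_coversP => x; have [u [v ->]] := cube_joinP m q x.
have [c cC uc] := covC u; have [d dD vd] := covD v.
by exists (cube_join m q c d); [exact: mem_code_join | exact: down_ball_join].
Qed.

(** * Weight classes and coverings of radius 1 *)

Definition raise (n : nat) (i : 'I_n) (u : cube n) : cube n :=
  [ffun j => (j == i) || u j].

Lemma down_ball_raise (n : nat) (i : 'I_n) (u : cube n) :
  u \in down_ball (raise n i u) 1.
Proof.
rewrite inE; apply/andP; split.
  by apply/forallP => j; rewrite ffunE; case: (u j); rewrite ?orbT.
rewrite /hamming -(cards1 i); apply/subset_leq_card/subsetP => j.
by rewrite !inE ffunE; case: (j == i); rewrite //= eqxx.
Qed.

(** The sum is taken in the additive group of ['I_m.+1], that is modulo [m.+1]; hence block lengths
    are written as successors. *)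
Definition weight (m : nat) (u : cube m.+1) : 'I_m.+1 := \sum_(i | u i) i.

Lemma weight_raise (m : nat) (i : 'I_m.+1) (u : cube m.+1) :
  ~~ u i -> weight m (raise m.+1 i u) = i + weight m u.
Proof.
move=> ui0; rewrite /weight (bigD1 i) /=; last by rewrite ffunE eqxx.
congr (_ + _); apply: eq_bigl => j; rewrite ffunE.
by case: eqP => [->|_] /=; rewrite ?(negPf ui0) ?andbT.
Qed.

Definition weight_class (m : nat) (c : 'I_m.+1) : {set cube m.+1} :=
  [set u | weight m u == c].

Definition unraisable (m : nat) (c : 'I_m.+1) : {set cube m.+1} :=
  [set u : cube m.+1 | u (c - weight m u)].

Lemma sum_card_weight_class (m : nat) :
  (\sum_c #|weight_class m c| = 2 ^ m.+1)%N.
Proof.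
rewrite -card_cube -sum1_card (partition_big (weight m) predT) //=.
by apply: eq_bigr => c _; rewrite sum1dep_card cardsE.
Qed.

(** Flipping coordinate [i] exchanges this set with its complement. *)
Lemma card_coord_true (n : nat) (i : 'I_n) :
  (2 * #|[set u : cube n | u i]| = 2 ^ n)%N.
Proof.
pose flip (u : cube n) : cube n := [ffun j => (j == i) (+) u j].
have flipK : involutive flip.
  by move=> u; apply/ffunP => j; rewrite !ffunE addKb.
rewrite mul2n -addnn -card_cube -(cardsC [set u : cube n | u i]); congr (_ + _)%N.
rewrite -(card_imset _ (inv_inj flipK)); apply: eq_card => u.
by rewrite !inE -[u in LHS]flipK (mem_imset _ _ (inv_inj flipK)) inE ffunE eqxx.
Qed.

Lemma sum_card_unraisable (m : nat) :
  (2 * \sum_c #|unraisable m c| = m.+1 * 2 ^ m.+1)%N.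
Proof.
have -> : (\sum_c #|unraisable m c| =
           \sum_(i < m.+1) #|[set u : cube m.+1 | u i]|)%N.
  under eq_bigr => c _ do rewrite -sum1dep_card big_mkcond.
  under [RHS]eq_bigr => c _ do rewrite -sum1dep_card big_mkcond.
  rewrite exchange_big [RHS]exchange_big; apply: eq_bigr => u _ /=.
  (* For fixed [u], the map from [c] to [c - weight m u] permutes the coordinates, so [u] is
     unraisable for as many classes as it has ones. *)
  rewrite [RHS](reindex_inj (addIr (- weight m u))); exact: eq_bigr.
rewrite big_distrr /=; under eq_bigr do rewrite card_coord_true.
by rewrite sum_nat_const card_ord.
Qed.

Lemma Kplus1_weight_class (m q : nat) (c : 'I_m.+1) :
  (Kplus (m.+1 + q) 1 <=
   #|weight_class m c| * 2 ^ q + #|unraisable m c| * Kplus q 1)%N.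
Proof.
have [[D /down_coversP covD <-] _] := KplusP q 1.
set C := code_join m.+1 q (weight_class m c) setT
         :|: code_join m.+1 q (unraisable m c) D.
apply: (@leq_trans #|C|); last first.
  rewrite -card_cube -cardsT (leq_trans (leq_card_setU _ _)) //.
  by rewrite leq_add // card_code_join.
apply/Kplus_le_card/down_coversP => x.
have [u [v ->]] := cube_joinP m.+1 q x.
have [uU | uNU] := boolP (u \in unraisable m c).
  have [d dD vd] := covD v; exists (cube_join m.+1 q u d).
    by rewrite inE (mem_code_join _ _ _ _ _ _ uU dD) orbT.
  (* The radius is spent as 0 + 1 here, on the second block, and as 1 + 0 in the raisable case. *)
  exact: (down_ball_join _ _ 0 1 _ _ _ _ (down_ball_refl _ _) vd).
exists (cube_join m.+1 q (raise m.+1 (c - weight m u) u) v).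
  rewrite inE mem_code_join // inE weight_raise ?subrK //.
  by rewrite inE in uNU.
exact: (down_ball_join _ _ 1 0 _ _ _ _ (down_ball_raise _ _ _) (down_ball_refl _ _)).
Qed.

(** Sum of the previous bound over all classes; doubling clears the one half coming from
    [card_coord_true]. *)
Lemma Kplus1_recursion (m q : nat) : (0 < m)%N ->
  (2 * m * Kplus (m + q) 1 <= 2 * 2 ^ (m + q) + m * 2 ^ m * Kplus q 1)%N.
Proof.
case: m => // m _.
have : (\sum_(c < m.+1) Kplus (m.+1 + q) 1 <= \sum_(c < m.+1)
   (#|weight_class m c| * 2 ^ q + #|unraisable m c| * Kplus q 1))%N.
  by apply: leq_sum => c _; exact: Kplus1_weight_class.
rewrite sum_nat_const card_ord big_split /= -!big_distrl /=.
rewrite sum_card_weight_class -expnD -sum_card_unraisable => le_sum.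
by rewrite -!mulnA -mulnDr leq_pmul2l.
Qed.

(** * Upper bounds by induction *)

Lemma Kplus1_upper (n : nat) : (Kplus n 1 * n <= 24 * 2 ^ n)%N.
Proof.
elim/ltn_ind: n => n IHn; have [n_lt4 | n_ge4] := ltnP n 4.
  by rewrite mulnC leq_mul ?Kplus_le_exp2 // (leq_trans (ltnW n_lt4)).
set m := (n %/ 4)%N; set q := (n - m)%N.
have def_n : n = (m + q)%N by rewrite /q /m; lia.
have m_gt0 : (0 < m)%N by rewrite /m; lia.
(* For q/m between 3 and 6 one has q^2 + 12 m^2 <= 11 m q, which is what lets the constant 24
   reproduce itself. *)
have q_ge : (3 * m <= q)%N by rewrite /q /m; lia.
have q_le : (q <= 6 * m)%N by rewrite /q /m; lia.
have q_ltn : (q < n)%N by lia.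
have := IHn q q_ltn; have := Kplus1_recursion m q m_gt0.
move: (Kplus q 1) => L; rewrite def_n expnD.
move: (Kplus (m + q) 1) (2 ^ m)%N (2 ^ q)%N => K M Q recK boundL.
(* Multiplying the recursion by [q] makes the product [L * q] appear, which the induction hypothesis
   bounds. *)
have mulK : (2 * m * q * K <= 2 * q * (M * Q) + 24 * m * (M * Q))%N.
  have := leq_mul (leqnn q) recK; have := leq_mul (leqnn (m * M)%N) boundL.
  nia.
(* Clearing [2 m q] from [mulK], what remains is [(m + q) (2 q + 24 m) <= 24 (2 m q)]. *)
have coef : ((m + q) * (2 * q + 24 * m) <= 24 * (2 * m * q))%N by nia.
have mq_gt0 : (0 < 2 * m * q)%N by nia.
rewrite -(leq_pmul2l mq_gt0).
have := leq_mul (leqnn (m + q)%N) mulK; have := leq_mul coef (leqnn (M * Q)%N).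
nia.
Qed.

Lemma Kplus_upper (R : nat) :
  exists A : nat, forall n, (Kplus n R * n ^ R <= A * 2 ^ n)%N.
Proof.
elim: R => [|R [A IHR]].
  by exists 1%N => n; rewrite muln1 mul1n Kplus_le_exp2.
(* The summand 1 serves n <= 1. Otherwise half of the coordinates get radius 1 and the rest radius
   [R]: 72 is 3 * 24, from n <= 3m and [Kplus1_upper], and [2 ^ R] comes from n <= 2q. *)
exists (1 + 72 * 2 ^ R * A)%N => n.
have [n_le1 | n_gt1] := leqP n 1.
  rewrite mulnC leq_mul ?Kplus_le_exp2 //.
  by rewrite (leq_trans (leq_exp2rW _ _ _ n_le1)) ?exp1n.
set m := n./2; set q := (n - m)%N.
have def_n : n = (m + q)%N by rewrite /q /m; lia.
have n_le3m : (n <= 3 * m)%N by rewrite /m; lia.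
have n_le2q : (n <= 2 * q)%N by rewrite /q /m; lia.
have K_le : (Kplus n R.+1 <= Kplus m 1 * Kplus q R)%N.
  by rewrite {1}def_n -add1n Kplus_join.
have pow_le : (n ^ R.+1 <= 3 * m * (2 ^ R * q ^ R))%N.
  by rewrite expnS -expnMn leq_mul // leq_exp2rW.
have := leq_mul K_le pow_le.
have := leq_mul (Kplus1_upper m) (IHR q).
rewrite [in (2 ^ n)%N]def_n expnD.
move: (Kplus n R.+1) (n ^ R.+1)%N (Kplus m 1) (Kplus q R) => K N K1 K2.
move: (q ^ R)%N (2 ^ m)%N (2 ^ q)%N (2 ^ R)%N => QR M Q E le1 le2.
apply: leq_trans le2 _.
have := leq_mul (leqnn (3 * E)%N) le1.
nia.
Qed.

(** * Lower bound by counting balls *)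

Lemma card_down_ball (n R : nat) (c : cube n) :
  (#|down_ball c R| <= n.+1 ^ R)%N.
Proof.
pose lower (f : {ffun 'I_R -> option 'I_n}) : cube n :=
  [ffun i => c i && (Some i \notin codom f)].
have -> : (n.+1 ^ R = #|{ffun 'I_R -> option 'I_n}|)%N.
  by rewrite card_ffun card_option !card_ord.
rewrite -cardsT; apply: leq_trans (leq_imset_card lower _).
apply/subset_leq_card/subsetP => y.
rewrite inE => /andP[/forallP le_yc]; rewrite /hamming.
set D := [set i | _] => cardD.
(* The coordinates where [c] and [y] differ are listed, and the default of [nth] pads the list to
   length [R]. *)
apply/imsetP; exists [ffun k : 'I_R => nth None (map some (enum D)) k] => //.
apply/ffunP => i; rewrite ffunE.
suff -> : (Some i \in codom [ffun k : 'I_R => nth None (map some (enum D)) k])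
          = (c i != y i).
  by move: (le_yc i); case: (c i); case: (y i).
have <- : (i \in D) = (c i != y i) by rewrite inE.
apply/codomP/idP => [[k] | iD].
  rewrite ffunE; have [k_lt | k_ge] := ltnP k (size (map some (enum D))).
    move=> def_i; have := mem_nth None k_lt; rewrite -def_i.
    by rewrite mem_map ?mem_enum // => ? ? [].
  by rewrite nth_default.
have idx_lt : (index i (enum D) < size (enum D))%N.
  by rewrite index_mem mem_enum.
have idx_ltR : (index i (enum D) < R)%N.
  by rewrite (leq_trans idx_lt) // -cardE.
exists (Ordinal idx_ltR).
by rewrite ffunE /= (nth_map i) // nth_index // mem_enum.
Qed.

Lemma Kplus_lower (n R : nat) : (2 ^ n <= Kplus n R * n.+1 ^ R)%N.
Proof.
have [[C /eqP covC <-] _] := KplusP n R.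
rewrite -card_cube -cardsT -covC -sum_nat_const.
apply: (@leq_trans (\sum_(c in C) #|down_ball c R|)%N); last first.
  by apply: leq_sum => c _; exact: card_down_ball.
elim/big_rec2: _ => [|c k B _ le_k]; first by rewrite cards0.
by rewrite (leq_trans (leq_card_setU _ _)) // leq_add2l.
Qed.

(** * The two bounds over the reals *)

Theorem theorem9 (K : realType) (R : nat) :
  exists (c C : K) (n0 : nat),
    [/\ 0 < c, 0 < C &
      forall n : nat, (n0 <= n)%N ->
        c * (2 ^+ n / n%:R ^+ R) <= (Kplus n R)%:R /\
        (Kplus n R)%:R <= C * (2 ^+ n / n%:R ^+ R)].
Proof.
have [A upper] := Kplus_upper R.
(* The factor [2 ^- R] absorbs (n + 1)^R <= (2n)^R, valid for n >= 1; the successor of [A] ensures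
   positivity. *)
exists (2 ^- R), A.+1%:R, 1%N; split=> [||n n_gt0].
- by rewrite invr_gt0 exprn_gt0.
- by rewrite ltr0Sn.
have nR_gt0 : 0 < n%:R ^+ R :> K by rewrite exprn_gt0 // ltr0n.
split; last first.
  rewrite mulrA ler_pdivlMr // -!natrX -!natrM ler_nat.
  by rewrite (leq_trans (upper n)) // leq_mul.
rewrite mulrA ler_pdivrMr // mulrC ler_pdivrMr ?exprn_gt0 //.
rewrite -!natrX -!natrM ler_nat (leq_trans (Kplus_lower n R)) //.
rewrite -mulnA leq_mul // -expnMn leq_exp2rW; lia.
Qed.
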